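(* Let $u$ be the (sufficiently regular) exact solution of ${}^C_0D^\alpha_t u(t)+Au(t)=f(t)$, $u(0)=u_0$, so that $$L^\alpha_t u(t_{k+1})+Au(t_{k+1})=f(t_{k+1})-\tilde R_{k+1},\qquad k=0,1,\ldots,K-1,$$ and let $u^k$ be the solution of the time stepping scheme $$L^\alpha_t u^{k+1}+Au^{k+1}=f^{k+1},\qquad k=0,1,\ldots,K-1,\qquad u^0=u_0,$$ with $u^{k+1}\in D(A)$. Then $$\Vert u(t_k)-u^k\Vert\le \frac{c_u}{1-\alpha}\,T^\alpha\,\Delta t^{2-\alpha},\qquad k=1,2,\ldots,K,$$ where $c_u$ is the constant in the truncation error bound $\Vert\tilde R_{k+1}\Vert\le c_u\Delta t^{2-\alpha}$, $0\le k\le K-1$.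
   Context: Let $0<\alpha<1$, $T>0$, and let $\Omega\subset\mathbb{R}^d$, $1\le d\le 3$, be a bounded open domain. Let $A=-\Delta$ with domain $D(A)=H^1_0(\Omega)\cap H^2(\Omega)$ (homogeneous Dirichlet boundary conditions). $\Vert\cdot\Vert$ is the $L^2(\Omega)$ norm. The Caputo derivative of order $\alpha$ is $${}^C_0D^\alpha_t u(x,t)=\frac{1}{\Gamma(1-\alpha)}\int_0^t\frac{\partial u(x,s)}{\partial s}\frac{ds}{(t-s)^\alpha}.$$ Time grid: $K\ge1$ is an integer, $\Delta t=T/K$, $t_k=k\Delta t$ for $k=0,\ldots,K$, and $f^{k+1}=f(t_{k+1})$. Coefficients: $b_j=(j+1)^{1-\alpha}-j^{1-\alpha}$ for $j\ge0$ and $\alpha_0=\Gamma(2-\alpha)\Delta t^\alpha$. Discrete fractional operator: for a sequence $(v^k)_{0\le k\le K}$ (in particular $v^k=u^k$ or $v^k=u(t_k)$, in which case one writes $L^\alpha_t u(t_{k+1})$), $$L^\alpha_t v^{k+1}=\frac1{\alpha_0}\Big(v^{k+1}-(1-b_1)v^k-\sum_{j=1}^{k-1}(b_j-b_{j+1})v^{k-j}-b_kv^0\Big)\quad(k\ge1),\qquad L^\alpha_t v^1=\frac1{\alpha_0}(v^1-v^0).$$ Equivalently, $L^\alpha_t v^{k+1}=\frac1{\alpha_0}\sum_{j=0}^k b_j\,(v^{k+1-j}-v^{k-j})$. Truncation error: $\tilde R_{k+1}={}^C_0D^\alpha_t u(t_{k+1})-L^\alpha_t u(t_{k+1})$. Standing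 assumption: the continuous problem has a unique solution $u$, with values $u(t)\in D(A)$, regular enough that there is a constant $c_u$ depending only on $u$ with $\Vert\tilde R_{k+1}\Vert\le c_u\Delta t^{2-\alpha}$ for all $0\le k\le K-1$. *)

(* Defs.v *)
From HB Require Import structures.
From mathcomp Require Import all_boot all_order all_algebra.
From mathcomp Require Import all_classical all_reals all_analysis.
From mathcomp Require Import measurable_realfun.

Set Implicit Arguments.
Unset Strict Implicit.
Unset Printing Implicit Defensive.
Import Order.TTheory GRing.Theory Num.Theory.
Import numFieldNormedType.Exports.
Local Open Scope classical_set_scope.
Local Open Scope ring_scope.

(* R^n is the type 'rV[R]_n of row vectors, with its Borel sigma-algebra. *)
HB.instance Definition _ (R : realType) (n : nat) :=
  @isMeasurable.Build (sigma_display (@open 'rV[R]_n)) 'rV[R]_n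
    <<s @open 'rV[R]_n >>
    (@sigma_algebra0 _ setT _) (@sigma_algebraC _ _)
    (@sigma_algebra_bigcup _ setT _).

Section borel_rV.
Context {R : realType}.

Lemma open_rV_measurable n (A : set 'rV[R]_n) : open A -> measurable A.
Proof. by move=> oA; apply: sub_sigma_algebra. Qed.

Lemma continuous_rV_measurable n m (f : 'rV[R]_n -> 'rV[R]_m) :
  continuous f -> measurable_fun setT f.
Proof.
move=> cf; apply: (@measurability _ _ _ _ _ _ (@open 'rV[R]_m)) => //.
move=> _ [B oB <-]; rewrite setTI; apply: open_rV_measurable.
by move/continuousP : cf; apply.
Qed.

Lemma continuous_rV_real_measurable n (f : 'rV[R]_n -> R) :
  continuous f -> measurable_fun setT f.
Proof.
move=> cf.
apply: (measurability _ (RGenOpens.measurableE R)).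
move=> _ [_ [a [b ->] <-]]; rewrite setTI; apply: open_rV_measurable.
by move/continuousP : cf; apply; exact: interval_open.
Qed.

Lemma open_rV_bigcup_ball n (A : set 'rV[R]_n) : open A ->
  A = \bigcup_(i : 'rV[rat]_n * nat)
        (if `[< ball (map_mx ratr i.1 : 'rV[R]_n) i.2.+1%:R^-1 `<=` A >]
         then ball (map_mx ratr i.1 : 'rV[R]_n) i.2.+1%:R^-1 else set0).
Proof.
move=> oA; apply/seteqP; split => [x Ax|x [i _]]; last first.
  by case: asboolP => // + xi; exact.
have /nbhs_ballP[e /= e0 eA] := open_nbhs_nbhs (conj oA Ax).
have e20 : 0 < e / 2 by rewrite divr_gt0.
have [m me] : exists m : nat, m.+1%:R^-1 < e / 2.
  exists (Num.truncn (e / 2)^-1).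
  rewrite invf_plt ?posrE//; exact: truncnS_gt.
have m0 : 0 < m.+1%:R^-1 :> R by rewrite invr_gt0.
have qP (j : 'I_n) : exists q : rat, `|x 0 j - ratr q| < m.+1%:R^-1.
  have [q /itvP qx] : exists q : rat,
      ratr q \in `](x 0 j - m.+1%:R^-1), (x 0 j + m.+1%:R^-1)[.
    by apply: rat_in_itvoo; rewrite ltrBlDr -addrA ltrDl addr_gt0.
  by exists q; rewrite ltr_distlC !qx.
have [q qE] := choice qP.
exists (\row_j q j, m) => //=.
have xq : ball (map_mx ratr (\row_j q j) : 'rV[R]_n) m.+1%:R^-1 x.
  split => // i j; rewrite !mxE ord1 /ball/= distrC; exact: qE.
case: asboolP => // -[]; apply: subset_trans eA => y qy.
rewrite [e]splitr; apply: (@ball_triangle _ _ (map_mx ratr (\row_j q j) : 'rV[R]_n)).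
  by apply: (le_ball (ltW me)); apply: ball_sym.
exact: (le_ball (ltW me)).
Qed.

Definition rV_cons n (z : measurableTypeR R * 'rV[R]_n) : 'rV[R]_n.+1 :=
  row_mx (z.1%:M : 'rV_1) z.2.

Definition rV_uncons n (v : 'rV[R]_n.+1) : measurableTypeR R * 'rV[R]_n :=
  (v 0 0, rsubmx (v : 'rV_(1 + n))).

Lemma rV_cons_head n (z : R * 'rV[R]_n) : rV_cons z 0 0 = z.1.
Proof.
have -> : (0 : 'I_n.+1) = lshift n (0 : 'I_1) by exact/val_inj.
by apply: etrans (row_mxEl _ _ _ _) _; rewrite mxE.
Qed.

Lemma rV_cons_tail n (z : R * 'rV[R]_n) (j : 'I_n) :
  rV_cons z 0 (rshift 1 j) = z.2 0 j.
Proof. exact: row_mxEr. Qed.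

Lemma rV_consK n : cancel (@rV_cons n) (@rV_uncons n).
Proof.
case=> x v; rewrite /rV_uncons rV_cons_head; congr pair.
exact: (@row_mxKr _ _ 1).
Qed.

Lemma measurable_rV_uncons n : measurable_fun setT (@rV_uncons n).
Proof.
apply: measurable_fun_pair.
  exact: continuous_rV_real_measurable (@coord_continuous _ _ _ _ _).
exact: continuous_rV_measurable (@continuous_rsubmx _ _ 1 n).
Qed.

Lemma measurable_rV_cons n : measurable_fun setT (@rV_cons n).
Proof.
apply: (@measurability _ _ _ _ _ _ (@open 'rV[R]_n.+1)) => //.
move=> _ [B oB <-]; rewrite setTI (open_rV_bigcup_ball oB) preimage_bigcup.
apply: countable_bigcupT_measurable => // i.
case: ifPn => _; last by rewrite preimage_set0.
set c := map_mx _ _; set r := _^-1.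
have r0 : 0 < r by rewrite /r invr_gt0.
have -> : @rV_cons n @^-1` ball c r =
    ball (c 0 0 : R) r `*` ball (rsubmx (c : 'rV_(1 + n))) r.
  apply/seteqP; split => -[x v] /=.
    move=> [_ cr]; split => /=.
      by have := cr 0 0; rewrite rV_cons_head.
    split=> // k j; have := cr 0 (rshift 1 j).
    by rewrite rV_cons_tail (ord1 k) [rsubmx _ _ _]mxE.
  move=> [/= cx [_ cv]]; split => // k j.
  rewrite ord1; case: (split_ordP (j : 'I_(1 + n))) => l ->.
    have -> : lshift n l = 0 :> 'I_n.+1 by apply/val_inj; rewrite /= ord1.
    by rewrite rV_cons_head.
  by have := cv 0 l; rewrite rV_cons_tail [rsubmx _ _ _]mxE.
apply: measurableX; first by apply: open_measurable; apply: ball_open.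
by apply: open_rV_measurable; apply: ball_open.
Qed.

HB.instance Definition _ n := isMeasurableFun.Build _ _ _ _
  (@rV_cons n) (@measurable_rV_cons n).

End borel_rV.

Lemma product_sigma_finite d1 d2 (T1 : measurableType d1)
    (T2 : measurableType d2) (R : realType)
    (m1 : {sigma_finite_measure set T1 -> \bar R})
    (m2 : {sigma_finite_measure set T2 -> \bar R}) :
  sigma_finite setT (m1 \x m2)%E.
Proof.
have /sigma_finiteP[F [TF ndF Foo]] := sigma_finiteT m1.
have /sigma_finiteP[G [TG ndG Goo]] := sigma_finiteT m2.
exists (fun n => F n `*` G n).
  rewrite -setXTT TF TG predeqE => -[x y]; split.
    move=> [/= [n _ Fnx] [k _ Gky]]; exists (maxn n k) => //; split.
    - by move: x Fnx; exact/subsetPset/ndF/leq_maxl.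
    - by move: y Gky; exact/subsetPset/ndG/leq_maxr.
  by move=> [n _ []/= ? ?]; split; exists n.
move=> k; have [? ?] := Foo k; have [? ?] := Goo k.
split; first exact: measurableX.
by rewrite product_measure1E// lte_mul_pinfty// ge0_fin_numE.
Qed.

Section lebesgue_cons.
Context {R : realType} {n : nat}.
Variable m : {sigma_finite_measure set 'rV[R]_n -> \bar R}.

(* The image of the product of the one-dimensional Lebesgue measure with m. *)
Definition lebesgue_cons : set 'rV[R]_n.+1 -> \bar R :=
  pushforward (@lebesgue_measure R \x m)%E (@rV_cons R n).

Let lebesgue_cons0 : lebesgue_cons set0 = 0%E.
Proof. exact: measure0. Qed.

Let lebesgue_cons_ge0 A : (0 <= lebesgue_cons A)%E.
Proof. exact: measure_ge0. Qed.

Let lebesgue_cons_sigma_additive : semi_sigma_additive lebesgue_cons.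
Proof. exact: measure_semi_sigma_additive. Qed.

HB.instance Definition _ := isMeasure.Build _ _ _ lebesgue_cons
  lebesgue_cons0 lebesgue_cons_ge0 lebesgue_cons_sigma_additive.

Let lebesgue_cons_sigma_finite : sigma_finite setT lebesgue_cons.
Proof.
have [F TF Foo] := product_sigma_finite (@lebesgue_measure R) m.
exists (fun k => @rV_uncons R n @^-1` F k).
  by rewrite -preimage_bigcup -TF preimage_setT.
move=> k; have [mF Fk] := Foo k; split.
  by rewrite -[X in measurable X]setTI; exact: measurable_rV_uncons.
rewrite /lebesgue_cons /pushforward -comp_preimage.
by rewrite (_ : _ \o _ = id) //; apply/funext => z /=; rewrite rV_consK.
Qed.

HB.instance Definition _ := Measure_isSigmaFinite.Build _ _ _ lebesgue_cons
  lebesgue_cons_sigma_finite.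

End lebesgue_cons.

Fixpoint lebesgue_rV (R : realType) (n : nat) :
    {sigma_finite_measure set 'rV[R]_n -> \bar R} :=
  match n with
  | 0%N => dirac (0 : 'rV[R]_0)
  | n'.+1 => lebesgue_cons (lebesgue_rV R n')
  end.

Section sobolev.
Context {R : realType} {d : nat}.
Implicit Types (w v : 'rV[R]_d -> R) (g : 'I_d -> 'rV[R]_d -> R).

Definition partial (i : 'I_d) w : 'rV[R]_d -> R := 'D_('e_i) w.

Definition iter_partial (s : seq 'I_d) w := foldr partial w s.

Definition smooth w := forall s : seq 'I_d,
  continuous (iter_partial s w) /\
  forall i x, derivable (iter_partial s w) x 'e_i.

Variables (Omega : set 'rV[R]_d) (oOmega : open Omega).

Definition test_fun w :=
  [/\ smooth w, compact (closure [set x | w x != 0])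
    & closure [set x | w x != 0] `<=` Omega].

(* Lebesgue measure on Omega. It ignores the complement of Omega, so a function
   on R^d stands for its restriction to Omega, and elements of L^2(Omega) are
   represented up to equality almost everywhere for this measure. *)
Definition leb : {measure set 'rV[R]_d -> \bar R} :=
  mrestr (lebesgue_rV R d) (open_rV_measurable oOmega).

Definition L2 w := w \in Lfun leb 2%:E.

Definition L2norm w : \bar R := 'N[leb]_2%:E[EFin \o w]%E.

Definition weak_partial (i : 'I_d) w v := forall phi, test_fun phi ->
  \int[leb]_x (w x * partial i phi x) = - \int[leb]_x (v x * phi x).

(* w is in H^1(Omega), with weak gradient g *)
Definition weak_gradient w g :=
  L2 w /\ forall i, L2 (g i) /\ weak_partial i w (g i).

Definition H1norm w g : \bar R :=
  ((L2norm w `^ 2 + \sum_(i < d) L2norm (g i) `^ 2) `^ 2^-1)%E.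

(* the closure of the test functions in H^1(Omega) *)
Definition in_H10 w := exists2 g, weak_gradient w g &
  forall eps : R, 0 < eps -> exists2 phi, test_fun phi &
    (H1norm (w \- phi)%R (fun i => g i \- partial i phi)%R < eps%:E)%E.

(* w is in H^2(Omega), with weak gradient g and weak Hessian h *)
Definition weak_hessian w g (h : 'I_d -> 'I_d -> 'rV[R]_d -> R) :=
  weak_gradient w g /\ forall i, weak_gradient (g i) (h i).

Definition in_H2 w := exists g h, weak_hessian w g h.

Definition in_DA w := in_H10 w /\ in_H2 w.

(* graph of the operator A = - Laplacian, with domain H^1_0 `&` H^2 *)
Definition A_graph w v := in_DA w /\
  exists g h, weak_hessian w g h /\
    v = (fun x => - \sum_(i < d) h i i x) %[ae leb].

End sobolev.

Section fractional.
Context {R : realType}.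
Implicit Types (alpha dt t : R) (k j : nat).

Definition Gamma (s : R) : R :=
  \int[lebesgue_measure]_(x in `]0, +oo[) (x `^ (s - 1) * expR (- x)).

Definition caputo_integrand alpha (y : R -> R) t (s : R) : R :=
  (y^`())%classic s / (t - s) `^ alpha.

Definition caputo alpha (y : R -> R) t : R :=
  (Gamma (1 - alpha))^-1 *
  \int[lebesgue_measure]_(s in `]0, t[) caputo_integrand alpha y t s.

(* [derive1] and the integral are total functions: this is the condition under
   which [caputo] has its intended meaning. *)
Definition caputo_defined alpha (y : R -> R) t :=
  [/\ {within `[0, t], continuous y},
      {in `]0, t[, forall s, derivable y s 1} &
      lebesgue_measure.-integrable `]0, t[
        (EFin \o caputo_integrand alpha y t)].

Definition coef_b alpha j : R :=
  j.+1%:R `^ (1 - alpha) - j%:R `^ (1 - alpha).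

Definition alpha0 alpha dt : R := Gamma (2 - alpha) * dt `^ alpha.

(* [frac_diff alpha dt y k] is the discrete operator at index k.+1. *)
Definition frac_diff alpha dt (y : nat -> R) k : R :=
  (alpha0 alpha dt)^-1 *
  (if k == 0%N then y 1%N - y 0%N else
    y k.+1 - (1 - coef_b alpha 1) * y k
    - \sum_(1 <= j < k) (coef_b alpha j - coef_b alpha j.+1) * y (k - j)%N
    - coef_b alpha k * y 0%N).

End fractional.

Section problem.
Context {R : realType} {d : nat}.
Variables (Omega : set 'rV[R]_d) (oOmega : open Omega).
Variables (alpha T : R).

Notation time_fun := (R -> 'rV[R]_d -> R).

Record exact_solution (f : time_fun) (u0 : 'rV[R]_d -> R) (u : time_fun)
    : Prop := {
  exact_DA : forall t, 0 <= t <= T -> in_DA oOmega (u t) ;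
  exact_init : u 0 = u0 %[ae leb oOmega] ;
  exact_caputo_defined : forall t, 0 < t <= T ->
    {ae leb oOmega, forall x, caputo_defined alpha (u ^~ x) t} ;
  exact_caputo_L2 : forall t, 0 < t <= T ->
    L2 oOmega (fun x => caputo alpha (u ^~ x) t) ;
  exact_eqn : forall t, 0 < t <= T -> exists2 v, A_graph oOmega (u t) v &
    (fun x => caputo alpha (u ^~ x) t + v x) = f t %[ae leb oOmega]
}.

Variable K : nat.

Definition step : R := T / K%:R.

Definition grid (k : nat) : R := k%:R * step.

(* the truncation error at index k.+1 *)
Definition truncation_error (u : time_fun) k (x : 'rV[R]_d) : R :=
  caputo alpha (u ^~ x) (grid k.+1)
  - frac_diff alpha step (fun j => u (grid j) x) k.

Record scheme_solution (f : time_fun) (u0 : 'rV[R]_d -> R)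
    (U : nat -> 'rV[R]_d -> R) : Prop := {
  scheme_L2 : L2 oOmega (U 0%N) ;
  scheme_init : U 0%N = u0 %[ae leb oOmega] ;
  scheme_eqn : forall k, (k < K)%N ->
    exists2 v, A_graph oOmega (U k.+1) v &
    (fun x => frac_diff alpha step (U ^~ x) k + v x)
      = f (grid k.+1) %[ae leb oOmega]
}.

End problem.

(* Main.v *)
Require Import Defs.
From HB Require Import structures.
From mathcomp Require Import all_boot all_order all_algebra.
From mathcomp Require Import all_classical all_reals all_analysis.
From mathcomp Require Import measurable_realfun ring lra.

Set Implicit Arguments.
Unset Strict Implicit.
Unset Printing Implicit Defensive.
Import Order.TTheory GRing.Theory Num.Theory.
Import numFieldNormedType.Exports.
Local Open Scope classical_set_scope.
Local Open Scope ring_scope.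

(* The error [e k = u (t k) - U k] satisfies the scheme with the truncation error
   as source. Testing against [e k.+1] and using that the Dirichlet Laplacian is
   monotone, by Green's formula on the closure of the test functions, gives
   [|e k.+1| <= sum_(j < k) (b j - b j.+1) |e (k - j)| + b k |e 0| + alpha0 |r|]
   where [r] is the truncation error. The weights [b j - b j.+1] are nonnegative
   and telescope, so [|e k.+1| <= alpha0 max |r| / b k] by induction. Concavity
   of [x ^ (1 - alpha)] gives [1 / b k <= (k + 1) ^ alpha / (1 - alpha)], and
   [Gamma (2 - alpha) <= 1] because [x ^ (s - 1) <= (s - 1) x + 2 - s] for
   [1 <= s <= 2], whose right-hand side integrates to 1 against [e ^ (- x)]. *)

(** * Concavity of [x ^ a] for [0 < a < 1] *)

Section powR_concave.
Context {R : realType}.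
Implicit Types a x y : R.

(** Young's inequality for the product of [x ^ a] and 1, with conjugate exponents [1 / a] and
    [1 / (1 - a)]. *)
Lemma powR_bernoulli a x : 0 < a < 1 -> 0 <= x -> x `^ a <= 1 + a * (x - 1).
Proof.
move=> /andP[a0 a1] x0.
have a1' : 0 < 1 - a by rewrite subr_gt0.
have := @conjugate_powR R (x `^ a) 1 a^-1 (1 - a)^-1 (powR_ge0 _ _) ler01.
rewrite !invr_gt0 !invrK subrKC mulr1 => /(_ a0 a1' erefl).
rewrite -powRrM mulfV ?gt_eqF// powRr1// powR1 mul1r => /le_trans; apply.
by rewrite le_eqVlt; apply/orP; left; apply/eqP; ring.
Qed.

(** Bernoulli's inequality at [y / x], multiplied by [x ^ a]. The point of contact [x] must be
    positive, but [y = 0] is allowed, which the weight [b 0] requires. *)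
Lemma powR_tangent a x y : 0 < a < 1 -> 0 < x -> 0 <= y ->
  y `^ a <= x `^ a + a * x `^ (a - 1) * (y - x).
Proof.
move=> a01 x0 y0.
have xa : x `^ (a - 1) = x `^ a / x.
  by rewrite powRB ?powRr1 ?(ltW x0)//; apply/implyP => _; rewrite gt_eqF.
have := powR_bernoulli a01 (divr_ge0 y0 (ltW x0)).
rewrite -(ler_pM2l (powR_gt0 a x0)) -powRM ?divr_ge0 ?(ltW x0)//.
rewrite mulrC divfK ?gt_eqF// => /le_trans; apply.
rewrite xa le_eqVlt; apply/orP; left; apply/eqP; field.
by rewrite gt_eqF.
Qed.

End powR_concave.

(** * The convolution weights and a discrete Gronwall inequality *)

Section coef_b.
Context {R : realType}.
Variable alpha : R.
Hypothesis alpha01 : 0 < alpha < 1.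

Local Notation b := (coef_b alpha).

Let alphaC01 : 0 < 1 - alpha < 1.
Proof. by move: alpha01 => /andP[? ?]; apply/andP; split; lra. Qed.

Lemma coef_b0 : b 0%N = 1.
Proof.
rewrite /coef_b powR1 powR0 ?subr0//.
by case/andP: alphaC01 => + _; rewrite lt0r => /andP[].
Qed.

(** The tangent of [x ^ (1 - alpha)] at [j + 1], evaluated one unit to the left. *)
Lemma coef_b_ge j : (1 - alpha) * j.+1%:R `^ (- alpha) <= b j.
Proof.
have := @powR_tangent R (1 - alpha) j.+1%:R j%:R alphaC01.
rewrite ltr0n ler0n => /(_ isT isT).
rewrite (_ : 1 - alpha - 1 = - alpha); last ring.
rewrite (_ : j%:R - j.+1%:R = -1); last by rewrite -natr1; ring.
by rewrite /coef_b; lra.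
Qed.

(** The same tangent at [j + 1], evaluated one unit to the right: its slope therefore separates
    [b j.+1] from [b j], which makes the weights nonincreasing. *)
Lemma coef_b_le j : b j.+1 <= (1 - alpha) * j.+1%:R `^ (- alpha).
Proof.
have := @powR_tangent R (1 - alpha) j.+1%:R j.+2%:R alphaC01.
rewrite ltr0n ler0n => /(_ isT isT).
rewrite (_ : 1 - alpha - 1 = - alpha); last ring.
rewrite (_ : j.+2%:R - j.+1%:R = 1); last by rewrite -natr1; ring.
by rewrite /coef_b; lra.
Qed.

Lemma coef_b_gt0 j : 0 < b j.
Proof.
apply: lt_le_trans (coef_b_ge j); rewrite mulr_gt0 ?powR_gt0//.
by case/andP: alphaC01.
Qed.

Lemma coef_bS_le j : b j.+1 <= b j.
Proof. exact: le_trans (coef_b_le j) (coef_b_ge j). Qed.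

Lemma coef_b_nincr i j : (i <= j)%N -> b j <= b i.
Proof.
move=> /subnKC <-; elim: (j - i)%N => [|n IH]; first by rewrite addn0.
by rewrite addnS; exact: le_trans (coef_bS_le _) IH.
Qed.

Lemma coef_b_inv_le j : (b j)^-1 <= j.+1%:R `^ alpha / (1 - alpha).
Proof.
have := coef_b_ge j.
rewrite powRN -lef_pV2 ?posrE ?coef_b_gt0//; last first.
  by rewrite mulr_gt0 ?invr_gt0 ?powR_gt0//; case/andP: alphaC01.
by rewrite invfM invrK mulrC.
Qed.

(** Since [b 0 = 1], the coefficient [1 - b 1] is the term [j = 0] of the sum, and the first time
    step is the case of an empty sum. One formula then serves all [k]. *)
Lemma frac_diffE dt (y : nat -> R) k : frac_diff alpha dt y k =
  (alpha0 alpha dt)^-1 *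
  (y k.+1 - \sum_(j < k) (b j - b j.+1) * y (k - j)%N - b k * y 0%N).
Proof.
rewrite /frac_diff; congr (_ * _); case: k => [|k] /=.
  by rewrite big_ord0 coef_b0 mul1r subr0.
rewrite -(big_mkord xpredT (fun j => (b j - b j.+1) * y (k.+1 - j)%N)).
by rewrite [in RHS]big_ltn// subn0 coef_b0 [in RHS]opprD !addrA.
Qed.

(* The induction hypothesis [E j <= M / b (j - 1)] is weakened to the common
   bound [M / b k], after which the weights telescope to [b 0 - b k]. *)
Lemma fractional_gronwall (E : nat -> R) (M : R) K : 0 <= M -> E 0%N <= 0 ->
  (forall k, (k < K)%N ->
    E k.+1 <= \sum_(j < k) (b j - b j.+1) * E (k - j)%N + b k * E 0%N + M) ->
  forall k, (k < K)%N -> E k.+1 <= M / b k.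
Proof.
move=> M0 E0 EM; elim/ltn_ind => k IH kK.
apply: (le_trans (EM k kK)).
have sumE : \sum_(j < k) (b j - b j.+1) * E (k - j)%N
    <= (1 - b k) * (M / b k).
  apply: (@le_trans _ _ (\sum_(j < k) (b j - b j.+1) * (M / b k))).
    apply: ler_sum => j _; apply: ler_wpM2l.
      by rewrite subr_ge0 coef_bS_le.
    have -> : (k - j)%N = (k - j.+1).+1 by rewrite -subSn.
    apply: (le_trans (IH _ _ _)).
    - by rewrite ltn_subrL ltn0Sn/= (leq_ltn_trans _ (ltn_ord j)).
    - by rewrite (leq_ltn_trans (leq_subr _ _)).
    - rewrite ler_wpM2l// lef_pV2 ?posrE ?coef_b_gt0//.
      exact/coef_b_nincr/leq_subr.
  rewrite -mulr_suml.
  suff -> : \sum_(j < k) (b j - b j.+1) = 1 - b k by [].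
  rewrite -coef_b0 -(big_mkord xpredT (fun j => b j - b j.+1)).
  rewrite (telescope_sumr_eq (fun j => - b j))// ?opprK 1?addrC// => j _.
  by rewrite opprK addrC.
have bE0 : b k * E 0%N <= 0 by rewrite mulr_ge0_le0// ltW// coef_b_gt0.
have bM : b k * (M / b k) = M by rewrite mulrC divfK// gt_eqF// coef_b_gt0.
by move: sumE bE0; rewrite mulrBl mul1r bM; lra.
Qed.

End coef_b.

(** * Bounds on the Gamma function between 1 and 2 *)

Section Gamma_bounds.
Context {R : realType}.
Implicit Types a s x : R.
Local Notation mu := (@lebesgue_measure R).

(** [G a] is the Bernoulli majorant of [x ^ a] times [e ^ (- x)], and [F a] is an antiderivative of
    it. *)
Let G a x : R := (a * x + (1 - a)) * expR (- x).
Let F a x : R := - ((a * x + 1) * expR (- x)).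

Let is_derive_F a x : is_derive x 1 (F a) (G a x).
Proof. by rewrite /F /G; apply: is_derive_eq; rewrite /GRing.scale/=; ring. Qed.

Let derivable_F a x : derivable (F a) x 1.
Proof. by have [] := is_derive_F a x. Qed.

Let continuous_F a : continuous (F a).
Proof. by move=> x; exact/differentiable_continuous/derivable1_diffP. Qed.

Let continuous_G a : continuous (G a).
Proof.
move=> x; apply/differentiable_continuous/derivable1_diffP.
by rewrite /G; exact: ex_derive.
Qed.

(* [a x + 1 <= 2 (1 + x / 2) <= 2 e^(x/2)] *)
Let cvg_F a : 0 <= a <= 1 -> F a x @[x --> +oo] --> 0.
Proof.
move=> /andP[a0 a1].
apply: (@squeeze_cvgr _ _ _ _ (fun x => - (2 * expR (- (2^-1 * x)))) (cst 0)).
- near=> x; have x0 : 0 <= x by near: x; exact: nbhs_pinfty_ge.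
  rewrite /F lerN2 oppr_le0 mulr_ge0 ?expR_ge0 ?addr_ge0 ?mulr_ge0//= andbT.
  have -> : expR (- x) = expR (- (2^-1 * x)) * expR (- (2^-1 * x)).
    by rewrite -expRD; congr expR; field.
  rewrite mulrA ler_wpM2r ?expR_ge0// expRN ler_pdivrMr ?expR_gt0//.
  have ax : a * x <= x by rewrite ler_piMl.
  by have := expR_ge1Dx (2^-1 * x); lra.
- rewrite -oppr0 -[in X in _ --> X](mulr0 2); apply: cvgN; apply: cvgMr.
  apply: (@cvg_comp _ _ _ (fun x : R => 2^-1 * x) (fun z => expR (- z)) _
    (pinfty_nbhs R)); last exact: cvgr_expR.
  exact: gt0_cvgMry.
- exact: cvg_cst.
Unshelve. all: end_near. Qed.

(** [F a] rises from -1 at 0 to 0 at infinity, whatever [a] is. *)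
Let integral_G a : 0 <= a <= 1 -> (\int[mu]_(x in `](0%R : R), +oo[) (G a x)%:E = 1)%E.
Proof.
move=> /[dup] a01 /andP[a0 a1].
rewrite integral_itv_obnd_cbnd; last first.
  apply/measurable_EFinP; apply: measurable_funTS.
  exact: continuous_measurable_fun.
rewrite (@ge0_continuous_FTC2y _ _ (F a) _ 0).
- have -> : F a 0 = -1 by rewrite /F oppr0 expR0; ring.
  by rewrite -EFinB opprK add0r.
- move=> x x0; rewrite /G mulr_ge0 ?expR_ge0//.
  by rewrite addr_ge0 ?mulr_ge0 ?subr_ge0.
- exact: continuous_subspaceT.
- exact: cvg_F.
- by move=> x _.
- exact/cvg_at_right_filter/continuous_F.
- by move=> x _; rewrite derive1E; exact: derive_val.
Qed.

Let measurable_integrand s (D : set R) :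
  measurable_fun D (fun x => (x `^ (s - 1) * expR (- x))%:E).
Proof.
apply/measurable_EFinP; apply: measurable_funTS.
by apply: measurable_funM => //; apply: measurableT_comp.
Qed.

Let integrand_ge0 s x : (0 <= (x `^ (s - 1) * expR (- x))%:E)%E.
Proof. by rewrite lee_fin mulr_ge0 ?powR_ge0 ?expR_ge0. Qed.

(** Bernoulli's inequality with exponent [s - 1] puts the integrand below [G (s - 1)]. *)
Let integral_le1 s : 1 < s < 2 ->
  (\int[mu]_(x in `](0%R : R), +oo[) (x `^ (s - 1) * expR (- x))%:E <= 1)%E.
Proof.
move=> /andP[s1 s2]; rewrite -(@integral_G (s - 1)); last by apply/andP; split; lra.
apply: ge0_le_integral => //.
- exact: measurable_integrand.
- by apply/measurable_EFinP; apply: measurable_funTS; exact: continuous_measurable_fun.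
- move=> x; rewrite /= in_itv/= andbT => x0; rewrite lee_fin /G.
  rewrite ler_wpM2r ?expR_ge0//.
  have : 0 < s - 1 < 1 by apply/andP; split; lra.
  by move/powR_bernoulli => /(_ _ (ltW x0)); lra.
Qed.

Lemma Gamma_le1 s : 1 < s < 2 -> Gamma s <= 1.
Proof.
move=> /integral_le1 s1; rewrite /Gamma /Rintegral -[leRHS]/(fine 1%:E).
by apply: fine_le => //; rewrite ge0_fin_numE ?integral_ge0// (le_lt_trans s1) ?ltry.
Qed.

(** The real-valued integral would be 0 if the extended one were infinite, so positivity uses the
    upper bound as well as a lower one. *)
Lemma Gamma_gt0 s : 1 < s < 2 -> 0 < Gamma s.
Proof.
move=> /[dup] s12 /integral_le1 s1; rewrite /Gamma /Rintegral fine_gt0//.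
rewrite (le_lt_trans s1) ?ltry// andbT.
(* On [[1, 2]] the power is at least 1 and the exponential at least [e ^ (- 2)]. *)
apply: (@lt_le_trans _ _ (\int[mu]_(x in `[1%R, 2%R]) (expR (- 2))%:E)%E).
  rewrite integral_cst//= lebesgue_measure_itv/= lte_fin ltr1n -EFinD -EFinM.
  by rewrite lte_fin mulr_gt0 ?expR_gt0// subr_gt0 ltr1n.
apply: (@le_trans _ _ (\int[mu]_(x in `[1%R, 2%R]) (x `^ (s - 1) * expR (- x))%:E)%E).
  apply: ge0_le_integral => //.
  - exact: measurable_integrand.
  - move=> x; rewrite /= in_itv/= => /andP[x1 x2]; rewrite lee_fin.
    rewrite -[leLHS]mul1r ler_pM ?expR_ge0//; last by rewrite ler_expR lerN2.
    rewrite -[leLHS](powRr0 x) ler_powR//; case/andP: s12 => s1' _.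
    by rewrite subr_ge0 ltW.
apply: ge0_subset_integral => //; first exact: measurable_integrand.
by move=> x /=; rewrite !in_itv/= andbT => /andP[x1 _]; rewrite (lt_le_trans ltr01).
Qed.

End Gamma_bounds.

(** * The inner product and norm of square integrable functions *)

Section L2_inner_product.
Context d (T : measurableType d) (R : realType).
Variable mu : {measure set T -> \bar R}.
Implicit Types f g h : T -> R.
Local Notation L2 f := (f \in Lfun mu 2%:E).

Definition ip f g : R := \int[mu]_x (f x * g x).

Definition nrm f : R := Num.sqrt (ip f f).

Lemma Lfun2_measurable f : L2 f -> measurable_fun setT f.
Proof. by move=> /sub_Lfun_mfun; rewrite inE. Qed.

Lemma Lfun2D f g : L2 f -> L2 g -> L2 (f \+ g).
Proof.
by have [_] := @Lfun_addr_closed _ T R mu 2%:E (lee1n 2); exact.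
Qed.

Lemma Lfun2Z a f : L2 f -> L2 (fun x => a * f x).
Proof.
move=> f2; have := @Lfun_scale _ _ _ mu f a 2 _ f2.
have -> : (fun x => a * f x) = a \o* f by apply/funext => x /=; rewrite mulrC.
by apply; rewrite ler1n.
Qed.

Lemma Lfun2B f g : L2 f -> L2 g -> L2 (f \- g).
Proof.
move=> f2 g2; have := Lfun2D f2 (Lfun2Z (-1) g2).
by rewrite (_ : _ \+ _ = f \- g)//; apply/funext => x /=; rewrite mulN1r.
Qed.

Lemma Lfun2_sum (I : Type) (r : seq I) (P : pred I) (F : I -> T -> R) :
  (forall i, P i -> L2 (F i)) -> L2 (fun x => \sum_(i <- r | P i) F i x).
Proof.
move=> F2; elim: r => [|i r IH].
  have -> : (fun x => \sum_(i <- [::] | P i) F i x) = 0.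
    by apply/funext => x; rewrite big_nil.
  by have [] := @Lfun_addr_closed _ T R mu 2%:E (lee1n 2).
have [Pi|Pi] := boolP (P i); last first.
  by under eq_fun do rewrite big_cons (negPf Pi).
under eq_fun do rewrite big_cons Pi.
by apply: Lfun2D IH; exact: F2.
Qed.

Lemma ip_integrable f g : L2 f -> L2 g ->
  mu.-integrable setT (EFin \o (fun x => f x * g x)).
Proof. by move=> f2 g2; apply/Lfun1_integrable; exact: Lfun2_mul_Lfun1. Qed.

Lemma ipC f g : ip f g = ip g f.
Proof. by apply: eq_Rintegral => x _; rewrite mulrC. Qed.

Lemma ip_ge0 f : 0 <= ip f f.
Proof. by apply: Rintegral_ge0 => x _; rewrite -expr2 sqr_ge0. Qed.

Lemma nrm_ge0 f : 0 <= nrm f.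
Proof. exact: sqrtr_ge0. Qed.

Lemma nrm_sqr f : nrm f ^+ 2 = ip f f.
Proof. by rewrite sqr_sqrtr// ip_ge0. Qed.

Lemma ipDl f g h : L2 f -> L2 g -> L2 h -> ip (f \+ g) h = ip f h + ip g h.
Proof.
move=> f2 g2 h2; rewrite /ip -RintegralD//; [|exact: ip_integrable..].
by apply: eq_Rintegral => x _; rewrite mulrDl.
Qed.

Lemma ipZl a f h : L2 f -> L2 h -> ip (fun x => a * f x) h = a * ip f h.
Proof.
move=> f2 h2; rewrite /ip -RintegralZl//; last exact: ip_integrable.
by apply: eq_Rintegral => x _; rewrite mulrA.
Qed.

Lemma ipBl f g h : L2 f -> L2 g -> L2 h -> ip (f \- g) h = ip f h - ip g h.
Proof.
move=> f2 g2 h2; rewrite /ip -RintegralB//; [|exact: ip_integrable..].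
by apply: eq_Rintegral => x _; rewrite mulrBl.
Qed.

Lemma ipBr f g h : L2 f -> L2 g -> L2 h -> ip h (f \- g) = ip h f - ip h g.
Proof. by move=> f2 g2 h2; rewrite !(ipC h) ipBl. Qed.

Lemma ip_suml (I : Type) (r : seq I) (P : pred I) (F : I -> T -> R) h :
  (forall i, P i -> L2 (F i)) -> L2 h ->
  ip (fun x => \sum_(i <- r | P i) F i x) h = \sum_(i <- r | P i) ip (F i) h.
Proof.
move=> F2 h2; elim: r => [|i r IH].
  rewrite big_nil /ip.
  under eq_Rintegral do rewrite big_nil mul0r.
  by rewrite Rintegral_cst// mul0r.
rewrite big_cons; case: ifPn => Pi.
  rewrite -IH -ipDl//; [|exact: F2|exact: Lfun2_sum].
  by apply: eq_Rintegral => x _; rewrite big_cons Pi.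
by rewrite -IH; apply: eq_Rintegral => x _; rewrite big_cons (negPf Pi).
Qed.

Lemma eq_ae_ip f g h : L2 f -> L2 g -> L2 h -> f = g %[ae mu] ->
  ip f h = ip g h.
Proof.
move=> f2 g2 h2 fg; congr fine; apply: ae_eq_integral => //.
- exact: measurable_int (ip_integrable f2 h2).
- exact: measurable_int (ip_integrable g2 h2).
- by apply: filterS fg => x /[apply] ->.
Qed.

(** Links the extended-real norm of the theorem to the real number [nrm], on which the energy
    argument computes. *)
Lemma Lnorm2E f : L2 f -> ('N[mu]_2%:E[EFin \o f] = (nrm f)%:E)%E.
Proof.
move=> f2; have fint := ip_integrable f2 f2.
rewrite unlock /nrm -powR12_sqrt ?ip_ge0// -poweR_EFin; congr (_ `^ _)%E.
rewrite /ip /Rintegral fineK; last exact: integrable_fin_num.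
by apply: eq_integral => x _; rewrite /= powR_mulrn// real_normK ?num_real.
Qed.

Lemma Lfun2P f : measurable_fun setT f -> ('N[mu]_2%:E[EFin \o f] < +oo)%E ->
  L2 f.
Proof. by move=> mf nf; rewrite inE; apply/andP; split; rewrite inE. Qed.

(** Hölder's inequality with both exponents equal to 2. *)
Lemma ip_CS f g : L2 f -> L2 g -> `|ip f g| <= nrm f * nrm g.
Proof.
move=> f2 g2.
have := @hoelder _ T R mu f g 2 2 (Lfun2_measurable f2) (Lfun2_measurable g2).
rewrite !ltr0n => /(_ isT isT); rewrite [_ + _](_ : _ = 1); last by field.
move=> /(_ erefl); rewrite !Lnorm2E// Lnorm1 -EFinM => fg.
rewrite -lee_fin; apply: le_trans fg; rewrite /ip EFin_normr_Rintegral//; last exact: ip_integrable.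
apply: le_abse_integral => //.
exact: measurable_int (ip_integrable f2 g2).
Qed.

Lemma ip_le_nrm f g : L2 f -> L2 g -> ip f g <= nrm f * nrm g.
Proof. by move=> f2 g2; exact: le_trans (ler_norm _) (ip_CS f2 g2). Qed.

End L2_inner_product.

(** * Green's formula and monotonicity of the Dirichlet Laplacian *)

Section laplacian_form.
Context {R : realType} {d : nat}.
Variables (Omega : set 'rV[R]_d) (oOmega : open Omega).
Implicit Types w v phi : 'rV[R]_d -> R.
Local Notation mu := (leb oOmega).

(** Off its closed support [phi] vanishes on a neighbourhood, so its derivative vanishes there too
    and the support can only shrink. *)
Lemma test_fun_partial i phi :
  test_fun Omega phi -> test_fun Omega (partial i phi).
Proof.
move=> [sphi cphi phiO].
have sub : closure [set x | partial i phi x != 0]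
    `<=` closure [set x | phi x != 0].
  rewrite [X in _ `<=` X](closure_id _).1; last exact: closed_closure.
  apply: closureS => x /=; apply: contraNP => xphi.
  have phi0 : \forall y \near x, phi y = cst 0 y.
    have oC : open (~` closure [set y | phi y != 0]).
      by apply/closed_openC/closed_closure.
    apply: filterS (open_nbhs_nbhs (conj oC xphi)) => y yphi.
    by apply/eqP; apply: contra_notT yphi => yphi; exact: subset_closure.
  by rewrite /partial (near_eq_derive 'e_i phi0) derive_cst.
split.
(* The extra derivative is the innermost one, hence the last letter of the word [s]. *)
- move=> s; have := sphi (rcons s i).
  by rewrite /iter_partial foldr_rcons.
- by apply: subclosed_compact sub => //; exact: closed_closure.
- exact: subset_trans sub phiO.
Qed.

Lemma test_fun_measurable phi : test_fun Omega phi -> measurable_fun setT phi.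
Proof.
by case=> /(_ [::])[cphi _] _ _; exact: continuous_rV_real_measurable.
Qed.

Lemma L2norm_le_H1norm w (g : 'I_d -> 'rV[R]_d -> R) :
  (L2norm oOmega w <= H1norm oOmega w g)%E /\
  forall i, (L2norm oOmega (g i) <= H1norm oOmega w g)%E.
Proof.
have le_pow (x y : \bar R) : (0 <= x -> x `^ 2 <= y -> x <= y `^ 2^-1)%E.
  (* Write [x] as the square root of its square and use monotonicity of the root on the extended
     reals. *)
  move=> x0 xy; rewrite -[leLHS]poweRe1// -[X in (_ `^ X)%E](@mulfV _ 2)//.
  rewrite poweRrM; apply: gt0_ler_poweR => //; rewrite ?invr_ge0//.
    by rewrite in_itv/= leey poweR_ge0.
  by rewrite in_itv/= leey andbT (le_trans _ xy) ?poweR_ge0.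
have sum_ge0 (P : pred 'I_d) : (0 <= \sum_(i < d | P i) L2norm oOmega (g i) `^ 2)%E.
  by apply: sume_ge0 => i _; exact: poweR_ge0.
split => [|i]; apply: le_pow; rewrite ?Lnorm_ge0//.
  by rewrite leeDl.
by rewrite (bigD1 i)//= addeCA leeDl// adde_ge0// poweR_ge0.
Qed.

(** The content of [in_H10] with the gradient made explicit, so that Green's formula can refer to
    it. *)
Definition H10_gradient w (g : 'I_d -> 'rV[R]_d -> R) :=
  weak_gradient oOmega w g /\ forall eps : R, 0 < eps ->
    exists2 phi, test_fun Omega phi &
      (H1norm oOmega (w \- phi)%R (fun i => g i \- partial i phi)%R < eps%:E)%E.

(** The function [h] is square integrable as the difference of [f] and [f \- h], the latter having
    finite norm. This is how the approximating test functions and their derivatives enter L2. *)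
Lemma L2_near f h (eps : R) : L2 oOmega f -> measurable_fun setT h ->
  (L2norm oOmega (f \- h)%R < eps%:E)%E ->
  [/\ L2 oOmega h, L2 oOmega (f \- h) & nrm mu (f \- h) <= eps].
Proof.
move=> f2 mh fh.
have fh2 : L2 oOmega (f \- h).
  apply: Lfun2P; last exact: lt_trans fh (ltry _).
  by apply: measurable_funB => //; exact: Lfun2_measurable f2.
split => //; last by rewrite -lee_fin -Lnorm2E//; exact: ltW.
rewrite (_ : h = f \- (f \- h)); first exact: Lfun2B.
by apply/funext => x /=; rewrite opprB addrCA subrr addr0.
Qed.

Lemma H10_gradient_approx w g (eps : R) : H10_gradient w g -> 0 < eps ->
  exists2 phi, test_fun Omega phi &
    [/\ L2 oOmega phi, L2 oOmega (w \- phi) & nrm mu (w \- phi) <= eps] /\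
    forall i, [/\ L2 oOmega (partial i phi), L2 oOmega (g i \- partial i phi)
      & nrm mu (g i \- partial i phi) <= eps].
Proof.
move=> [[w2 g2] apx] /apx[phi tphi H1]; exists phi => //.
have [wH gH] := L2norm_le_H1norm (w \- phi) (fun i => g i \- partial i phi).
split => [|i].
  apply: L2_near => //; first exact: test_fun_measurable.
  exact: le_lt_trans wH H1.
apply: L2_near; first by have [] := g2 i.
  by apply: test_fun_measurable; exact: test_fun_partial.
exact: le_lt_trans (gH i) H1.
Qed.

Definition minus_laplacian (h : 'I_d -> 'I_d -> 'rV[R]_d -> R) :=
  fun x => - \sum_(i < d) h i i x.

Lemma minus_laplacian_L2 w g h : weak_hessian oOmega w g h ->
  L2 oOmega (minus_laplacian h).
Proof.
move=> [_ gh].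
have := Lfun2Z (-1) (@Lfun2_sum _ _ _ mu _ (index_enum 'I_d) xpredT
  (fun i => h i i) (fun i _ => ((gh i).2 i).1)).
by under eq_fun do rewrite mulN1r.
Qed.

(* The weak gradients [g] and [g'] of [w1] need not be compared: both have the
   same pairing with [partial i phi], itself a test function. *)
Lemma minus_laplacian_test w g g' h phi : weak_hessian oOmega w g h ->
  weak_gradient oOmega w g' -> test_fun Omega phi -> L2 oOmega phi ->
  ip mu (minus_laplacian h) phi = \sum_(i < d) ip mu (g' i) (partial i phi).
Proof.
move=> [[_ wg] gh] [_ wg'] tphi phi2.
have hii i : L2 oOmega (h i i) := ((gh i).2 i).1.
have -> : minus_laplacian h = (fun x => -1 * \sum_(i < d) h i i x).
  by apply/funext => x; rewrite mulN1r.
have s2 : L2 oOmega (fun x => \sum_(i < d) h i i x).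
  exact: (@Lfun2_sum _ _ _ mu _ _ _ (fun i => h i i) (fun i _ => hii i)).
rewrite ipZl// (ip_suml _ (fun i _ => hii i))//.
rewrite mulN1r -sumrN; apply: eq_bigr => i _.
have := (wg i).2 _ (test_fun_partial i tphi).
have := (wg' i).2 _ (test_fun_partial i tphi).
have := ((gh i).2 i).2 _ tphi.
rewrite -!/(ip mu _ _) => <- -> /oppr_inj ->.
by [].
Qed.

(** The identity holds for test functions, and by Cauchy-Schwarz both sides are continuous in [w2]
    for the H1 norm, so it extends to the closure. *)
Lemma green_formula w1 w2 g g1 g2 h : weak_hessian oOmega w1 g h ->
  weak_gradient oOmega w1 g1 -> H10_gradient w2 g2 ->
  ip mu (minus_laplacian h) w2 = \sum_(i < d) ip mu (g1 i) (g2 i).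
Proof.
move=> wh wg1 H10; have [[w22 g22] _] := H10.
have v2 := minus_laplacian_L2 wh.
set v := minus_laplacian h in v2 *.
(* [C] bounds the continuity constant of both sides together; the summand 1 makes it positive, so
   that [e / C] is an admissible accuracy. *)
pose C := nrm mu v + \sum_(i < d) nrm mu (g1 i) + 1.
have C0 : 0 < C by rewrite ltr_wpDl// addr_ge0 ?nrm_ge0// sumr_ge0// => i _; exact: nrm_ge0.
apply/eqP; rewrite -subr_eq0 -normr_le0; apply/ler_addgt0Pl => e e0; rewrite addr0.
have [phi tphi [[phi2 wphi2 wphi] gphi]] :=
  H10_gradient_approx H10 (divr_gt0 e0 C0).
have {}gphi i := gphi i.
have g12 i : L2 oOmega (g1 i) by have [] := wg1.2 i.
have {g22}g22 i : L2 oOmega (g2 i) by have [] := g22 i.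
(* The identity for [phi] cancels its own terms, leaving only approximation errors. *)
have -> : ip mu v w2 - \sum_(i < d) ip mu (g1 i) (g2 i) =
    ip mu v (w2 \- phi) - \sum_(i < d) ip mu (g1 i) (g2 i \- partial i phi).
  rewrite ipBr// (minus_laplacian_test wh wg1 tphi phi2).
  rewrite [X in _ = _ - X](_ : _ = \sum_(i < d) ip mu (g1 i) (g2 i) -
      \sum_(i < d) ip mu (g1 i) (partial i phi)); first by ring.
  rewrite -sumrB; apply: eq_bigr => i _; have [p2 _ _] := gphi i.
  exact: ipBr (g22 i) p2 (g12 i).
apply: (le_trans (ler_normB _ _)).
apply: (@le_trans _ _ ((nrm mu v + \sum_(i < d) nrm mu (g1 i)) * (e / C))).
  rewrite mulrDl mulr_suml; apply: lerD.
    by apply: (le_trans (ip_CS _ _)) => //; rewrite ler_wpM2l// nrm_ge0.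
  apply: (le_trans (ler_norm_sum _ _ _)); apply: ler_sum => i _.
  have [_ p2 pe] := gphi i.
  by apply: (le_trans (ip_CS (g12 i) p2)); rewrite ler_wpM2l// nrm_ge0.
rewrite mulrCA -[leRHS]mulr1 ler_pM2l// ler_pdivrMr// mul1r /C lerDl//.
Qed.

Lemma A_graphP w v : A_graph oOmega w v -> L2 oOmega w /\
  exists g h g', [/\ weak_hessian oOmega w g h, H10_gradient w g'
    & v = minus_laplacian h %[ae mu]].
Proof.
move=> [[[g' wg' H10] _] [g [h [wh vE]]]]; split; first by have [] := wg'.
by exists g, h, g'; split.
Qed.

(** The graph determines [v1] and [v2] only almost everywhere, so a square integrable representative
    [v] of the difference is supplied. *)
Lemma A_graph_monotone w1 w2 v1 v2 :
  A_graph oOmega w1 v1 -> A_graph oOmega w2 v2 ->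
  exists v, [/\ L2 oOmega v, v = v1 \- v2 %[ae mu]
    & 0 <= ip mu v (w1 \- w2)].
Proof.
move=> /A_graphP[w12 [g1 [h1 [G1 [wh1 H1 v1E]]]]].
move=> /A_graphP[w22 [g2 [h2 [G2 [wh2 H2 v2E]]]]].
have l1 := minus_laplacian_L2 wh1; have l2 := minus_laplacian_L2 wh2.
exists (minus_laplacian h1 \- minus_laplacian h2); split.
- exact: Lfun2B.
- by apply: filterS2 v1E v2E => x /= /(_ I) -> /(_ I) ->.
- have W1 := H1.1; have W2 := H2.1.
  have G12 i : L2 oOmega (G1 i) by have [] := W1.2 i.
  have G22 i : L2 oOmega (G2 i) by have [] := W2.2 i.
  rewrite ipBl ?ipBr//; last exact: Lfun2B.
  (* Using [G1] and [G2] on both sides of the pairing turns the four terms into the sum of the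
     squared norms of [G1 i \- G2 i]. *)
  rewrite (green_formula wh1 W1 H1) (green_formula wh1 W1 H2).
  rewrite (green_formula wh2 W2 H1) (green_formula wh2 W2 H2).
  rewrite -!sumrB; apply: sumr_ge0 => i _.
  rewrite -(ipBr (G12 i) (G22 i) (G12 i)) -(ipBr (G12 i) (G22 i) (G22 i)).
  rewrite -(ipBl (G12 i) (G22 i) (Lfun2B (G12 i) (G22 i))).
  exact: ip_ge0.
Qed.

End laplacian_form.

(** * Energy estimate for one time step *)

Section energy_estimate.
Context d (T : measurableType d) (R : realType).
Variables (mu : {measure set T -> \bar R}) (alpha dt : R) (k : nat).
Hypothesis alpha01 : 0 < alpha < 1.
Implicit Types y : nat -> T -> R.
Local Notation b := (coef_b alpha).
Local Notation L2 f := (f \in Lfun mu 2%:E).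

Let weighted_sum_L2 y : (forall j, (j <= k.+1)%N -> L2 (y j)) ->
  L2 (fun x => \sum_(j < k) (b j - b j.+1) * y (k - j)%N x).
Proof.
move=> y2; apply: (@Lfun2_sum _ _ _ mu _ _ _
  (fun (j : 'I_k) x => (b j - b j.+1) * y (k - j)%N x)) => j _.
by apply/Lfun2Z/y2; rewrite (leq_trans (leq_subr _ _)).
Qed.

Lemma frac_diff_L2 y : (forall j, (j <= k.+1)%N -> L2 (y j)) ->
  L2 (fun x => frac_diff alpha dt (y ^~ x) k).
Proof.
move=> y2; under eq_fun do rewrite frac_diffE//.
apply: Lfun2Z; apply: (@Lfun2B _ _ _ mu
    (fun x => y k.+1 x - \sum_(j < k) (b j - b j.+1) * y (k - j)%N x)
    (fun x => b k * y 0%N x)); last exact/Lfun2Z/y2.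
apply: Lfun2B; first exact: y2.
exact: weighted_sum_L2.
Qed.

Lemma ip_frac_diff y h : (forall j, (j <= k.+1)%N -> L2 (y j)) -> L2 h ->
  ip mu (fun x => frac_diff alpha dt (y ^~ x) k) h =
  frac_diff alpha dt (fun j => ip mu (y j) h) k.
Proof.
move=> y2 h2; rewrite frac_diffE//.
have S2 := weighted_sum_L2 y2.
have -> : (fun x => frac_diff alpha dt (y ^~ x) k) =
    (fun x => (alpha0 alpha dt)^-1 *
      ((y k.+1 \- (fun x => \sum_(j < k) (b j - b j.+1) * y (k - j)%N x))
       \- (fun x => b k * y 0%N x)) x).
  by apply/funext => x; rewrite frac_diffE.
have yk2 : L2 (y k.+1) by exact: y2.
have y02 : L2 (fun x => b k * y 0%N x) by exact/Lfun2Z/y2.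
rewrite ipZl//; last by apply: Lfun2B => //; exact: Lfun2B.
rewrite !ipBl//; last exact: Lfun2B.
rewrite ipZl//; last exact: y2.
congr (_ * (_ - _ - _)).
have yj2 (j : 'I_k) : L2 (y (k - j)%N).
  by apply: y2; rewrite (leq_trans (leq_subr _ _)).
rewrite (@ip_suml _ _ _ mu _ _ _
  (fun (j : 'I_k) x => (b j - b j.+1) * y (k - j)%N x))//.
  by apply: eq_bigr => j _; rewrite ipZl.
by move=> j _; exact: Lfun2Z.
Qed.

(** Pair the equation with [y k.+1], discard the nonnegative term in [v], bound the other pairings
    by Cauchy-Schwarz, and divide by the norm of [y k.+1]. *)
Lemma energy_step y r v : 0 < alpha0 alpha dt ->
  (forall j, (j <= k.+1)%N -> L2 (y j)) -> L2 r -> L2 v ->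
  (fun x => frac_diff alpha dt (y ^~ x) k + v x) = (fun x => - r x) %[ae mu] ->
  0 <= ip mu v (y k.+1) ->
  nrm mu (y k.+1) <= \sum_(j < k) (b j - b j.+1) * nrm mu (y (k - j)%N) +
    b k * nrm mu (y 0%N) + alpha0 alpha dt * nrm mu r.
Proof.
move=> a0 y2 r2 v2 yE vy0; set S := _ + _ + _.
have yk2 : L2 (y k.+1) by exact: y2.
have D2 := frac_diff_L2 y2.
have bk j : 0 <= b j - b j.+1 by rewrite subr_ge0 coef_bS_le.
have b0 j : 0 <= b j by exact/ltW/coef_b_gt0.
have S0 : 0 <= S.
  rewrite !addr_ge0//; last by rewrite mulr_ge0 ?nrm_ge0 ?(ltW a0).
    by apply: sumr_ge0 => j _; rewrite mulr_ge0 ?nrm_ge0.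
  by rewrite mulr_ge0 ?nrm_ge0.
(* A zero norm cannot be divided out; there the claim is just [0 <= S]. *)
have [->//|n0] := eqVneq (nrm mu (y k.+1)) 0.
have {}n0 : 0 < nrm mu (y k.+1) by rewrite lt0r n0 nrm_ge0.
rewrite -(ler_pM2r n0) -expr2 nrm_sqr.
have := eq_ae_ip (Lfun2D D2 v2) (Lfun2Z (-1) r2) yk2.
move=> /(_ _)/wrap[].
  by apply: filterS yE => x /= /[apply] ->; rewrite mulN1r.
rewrite ipDl// ip_frac_diff// ipZl// mulN1r frac_diffE// => /eqP.
(* [X] is the bracket of the discrete operator applied to the sequence of pairings. *)
set X := _ - _ - _ => eqX.
have {eqX}XE : X = alpha0 alpha dt * (- ip mu r (y k.+1) - ip mu v (y k.+1)).
  by rewrite -(eqP eqX) addrK mulVKf ?gt_eqF.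
have rle : - ip mu r (y k.+1) <= nrm mu r * nrm mu (y k.+1).
  by apply: le_trans (ip_CS r2 yk2); rewrite -normrN ler_norm.
have Xle : X <= alpha0 alpha dt * nrm mu r * nrm mu (y k.+1).
  by rewrite XE -mulrA ler_pM2l// lerBlDr (le_trans rle)// lerDl.
have Sle : \sum_(j < k) (b j - b j.+1) * ip mu (y (k - j)%N) (y k.+1) <=
    (\sum_(j < k) (b j - b j.+1) * nrm mu (y (k - j)%N)) * nrm mu (y k.+1).
  rewrite mulr_suml; apply: ler_sum => j _; rewrite -mulrA ler_wpM2l//.
  by apply: ip_le_nrm => //; apply: y2; rewrite (leq_trans (leq_subr _ _)).
have y0le : b k * ip mu (y 0%N) (y k.+1) <=
    b k * nrm mu (y 0%N) * nrm mu (y k.+1).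
  by rewrite -mulrA ler_wpM2l//; apply: ip_le_nrm => //; exact: y2.
by rewrite /S 2!mulrDl; move: Xle; rewrite /X; lra.
Qed.

End energy_estimate.

(** * Error equation and convergence bound *)

Section error_estimate.
Context {R : realType} {d : nat}.
Variables (Omega : set 'rV[R]_d) (oOmega : open Omega).
Variables (alpha T : R) (f : R -> 'rV[R]_d -> R) (u0 : 'rV[R]_d -> R).
Variables (u : R -> 'rV[R]_d -> R) (K : nat) (U : nat -> 'rV[R]_d -> R).
Hypothesis alpha01 : 0 < alpha < 1.
Hypothesis T0 : 0 < T.
Hypothesis K0 : (0 < K)%N.
Hypothesis hu : exact_solution oOmega alpha T f u0 u.
Hypothesis hU : scheme_solution oOmega alpha T K f u0 U.

Local Notation mu := (leb oOmega).
Local Notation dt := (step T K).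
Local Notation t k := (grid T K k).
Let e k := u (t k) \- U k.

Lemma step_gt0 : 0 < dt.
Proof. by rewrite divr_gt0 // ltr0n. Qed.

Lemma grid_le k : (k <= K)%N -> 0 <= t k <= T.
Proof.
move=> kK; rewrite mulr_ge0 ?(ltW step_gt0)//=.
rewrite /grid /step mulrCA ler_piMr ?(ltW T0)//.
by rewrite ler_pdivrMr ?ltr0n// mul1r ler_nat.
Qed.

Lemma alpha0_gt0 : 0 < alpha0 alpha dt.
Proof.
rewrite mulr_gt0 ?powR_gt0 ?step_gt0//; apply: Gamma_gt0.
by case/andP: alpha01 => ? ?; apply/andP; split; lra.
Qed.

Let exact_L2 k : (k <= K)%N -> L2 oOmega (u (t k)).
Proof. by move=> /grid_le/(exact_DA hu)[[g [u2 _] _] _]. Qed.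

Let scheme_iterate_L2 k : (k <= K)%N -> L2 oOmega (U k).
Proof.
case: k => [_|k kK]; first exact: scheme_L2 hU.
by have [v [[[g [U2 _] _] _] _] _] := scheme_eqn hU kK.
Qed.

Lemma error_L2 k : (k <= K)%N -> L2 oOmega (e k).
Proof. by move=> kK; apply: Lfun2B; [exact: exact_L2|exact: scheme_iterate_L2]. Qed.

Lemma truncation_error_L2 k : (k < K)%N -> L2 oOmega (truncation_error alpha T K u k).
Proof.
move=> kK; apply: Lfun2B.
  apply: (exact_caputo_L2 hu).
  by have /andP[_ ->] := grid_le kK; rewrite andbT mulr_gt0 ?step_gt0 ?ltr0n.
apply: (frac_diff_L2 _ alpha01 (y := fun j => u (t j))) => j jk.
by apply: exact_L2; exact: leq_trans jk kK.
Qed.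

Let error0 : nrm mu (e 0%N) = 0.
Proof.
have u2 := exact_L2 (leq0n K); have U2 := scheme_iterate_L2 (leq0n K).
have uU : u (t 0%N) = U 0%N %[ae mu].
  rewrite /grid mul0r; apply: filterS2 (exact_init hu) (scheme_init hU).
  by move=> x /= /(_ I) -> /(_ I) ->.
by rewrite /nrm /e ipBl ?(eq_ae_ip _ _ _ uU) ?subrr ?sqrtr0//; exact: Lfun2B.
Qed.

Let error_step k : (k < K)%N ->
  nrm mu (e k.+1) <=
    \sum_(j < k) (coef_b alpha j - coef_b alpha j.+1) * nrm mu (e (k - j)%N) +
    coef_b alpha k * nrm mu (e 0%N) +
    alpha0 alpha dt * nrm mu (truncation_error alpha T K u k).
Proof.
move=> kK.
have tk : 0 < t k.+1 <= T.
  by have /andP[_ ->] := grid_le kK; rewrite andbT mulr_gt0 ?step_gt0 ?ltr0n.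
have [v1 Av1 eq1] := exact_eqn hu tk.
have [v2 Av2 eq2] := scheme_eqn hU kK.
have [v [vL2 vE v0]] := A_graph_monotone Av1 Av2.
apply: (energy_step alpha01 _ _ _ vL2 _ v0) => //.
- exact: alpha0_gt0.
- by move=> j jk; apply: error_L2; exact: leq_trans jk kK.
- exact: truncation_error_L2.
- have frac_diffB x : frac_diff alpha dt (e ^~ x) k =
      frac_diff alpha dt (fun j => u (t j) x) k - frac_diff alpha dt (U ^~ x) k.
    rewrite !frac_diffE// -mulrBr; congr (_ * _).
    under eq_bigr do rewrite mulrBr.
    by rewrite sumrB /e /=; ring.
  (* Subtracting the two equations eliminates [f]; the Caputo derivative minus the discrete operator
     at [u] is the truncation error, which moves to the right with a minus sign. *)
  apply: filterS3 vE eq1 eq2 => x /= /(_ I) vx /(_ I) ux /(_ I) Ux _.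
  rewrite frac_diffB vx /truncation_error.
  by have := ux; rewrite -Ux; lra.
Qed.

Lemma error_le c k :
  (forall k, (k < K)%N -> nrm mu (truncation_error alpha T K u k) <= c) ->
  (k < K)%N -> nrm mu (e k.+1) <= c * (T `^ alpha / (1 - alpha)).
Proof.
move=> cP kK.
(* As there is at least one time step, [c] bounds some norm. *)
have c0 : 0 <= c by apply: le_trans (cP _ K0); exact: nrm_ge0.
have a0 := alpha0_gt0.
have /andP[al0 al1] := alpha01.
have := @fractional_gronwall _ _ alpha01 (fun k => nrm mu (e k))
  (alpha0 alpha dt * c) K.
rewrite error0 lexx mulr_ge0 ?(ltW a0)// => /(_ isT isT _ _ kK) H.
apply: (le_trans (H _)).
  move=> j jK; apply: (le_trans (error_step jK)).
  by rewrite error0 lerD2l ler_wpM2l ?(ltW a0)// cP.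
rewrite mulrAC mulrC ler_wpM2l//.
apply: (@le_trans _ _ (dt `^ alpha * (k.+1%:R `^ alpha / (1 - alpha)))).
  apply: ler_pM; rewrite ?(ltW a0) ?invr_ge0 ?(ltW (coef_b_gt0 _ _))//.
    rewrite ler_piMl ?powR_ge0//; apply: Gamma_le1.
    by apply/andP; split; lra.
  exact: coef_b_inv_le.
rewrite mulrA ler_wpM2r ?invr_ge0 ?subr_ge0 ?(ltW al1)//.
(* The powers of [dt] and [k + 1] combine into the power of the grid time [t k.+1], which is at most
   [T]. *)
rewrite mulrC -powRM ?(ltW step_gt0)//.
have /andP[tk0 tkT] := grid_le kK.
by rewrite ge0_ler_powR ?(ltW al0) ?nnegrE ?(ltW T0).
Qed.

End error_estimate.

Theorem theorem2p2 (R : realType) (d : nat) (hd : (1 <= d <= 3)%N)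
  (Omega : set 'rV[R]_d) (oOmega : open Omega) (bOmega : bounded_set Omega)
  (cOmega : connected Omega) (neOmega : Omega !=set0)
  (alpha T : R) (halpha : 0 < alpha < 1) (hT : 0 < T)
  (f : R -> 'rV[R]_d -> R)
  (hf : forall t, 0 <= t <= T -> L2 oOmega (f t))
  (u0 : 'rV[R]_d -> R) (hu0 : L2 oOmega u0)
  (u : R -> 'rV[R]_d -> R)
  (hu : exact_solution oOmega alpha T f u0 u)
  (c_u : R) (K : nat) (hK : (1 <= K)%N)
  (htrunc : forall k : nat, (k < K)%N ->
    (L2norm oOmega (truncation_error alpha T K u k)
      <= (c_u * step T K `^ (2 - alpha))%:E)%E)
  (U : nat -> 'rV[R]_d -> R)
  (hU : scheme_solution oOmega alpha T K f u0 U) :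
  forall k : nat, (1 <= k <= K)%N ->
    (L2norm oOmega (u (grid T K k) \- U k)%R
      <= (c_u / (1 - alpha) * T `^ alpha * step T K `^ (2 - alpha))%:E)%E.
Proof.
move=> [//|k] /= kK.
rewrite [L2norm _ _](Lnorm2E (error_L2 hT hK hu hU kK)) lee_fin.
have -> : c_u / (1 - alpha) * T `^ alpha * step T K `^ (2 - alpha) =
    c_u * step T K `^ (2 - alpha) * (T `^ alpha / (1 - alpha)) by ring.
apply: (error_le halpha hT hK hu hU) => // j jK.
by rewrite -lee_fin -(Lnorm2E (truncation_error_L2 halpha hT hK hu jK)) htrunc.
Qed.
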